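(* Let $2<\tau<3$ and $h_{\min}>0$ be fixed, and let $f:[0,\infty)\to(0,1]$ satisfy properties F1, F2 and F3 listed in the context. Then the function $h\mapsto c_{ab}(h)$ is decreasing in $h\ge 0$ for all $a,b>0$ with $a h_{\min}<b$ if and only if $f$ satisfies property F4, i.e. $u\mapsto -uf'(u)/f(u)$ is increasing in $u\ge 0$.
   Context: ''Decreasing'' and ''increasing'' are meant in the weak sense (nonincreasing, nondecreasing). For $f:[0,\infty)\to(0,1]$ consider the properties: F1: $f(0)=1$ and $f(u)$ decreases to $0$ as $u\to\infty$. F2: $r(u):=uf(u)$ increases to $1$ as $u\to\infty$. F3: $f$ is continuous and there are finitely many points $0=u_0<u_1<\dots<u_K<\infty$ such that $f$ is twice differentiable on each of the closed intervals $[u_{k-1},u_k]$ and on $[u_K,\infty)$ (one-sided derivatives at the endpoints). At the breakpoints the symbol $f'$ is defined by the convention $f'(u_k)=\frac12 f'(u_k+0)+\frac12 f'(u_k-0)$ for $k=1,\dots,K$, and $f'(0)=f'(+0)$, where $f'(u\pm0)$ denote one-sided limits of the derivative. F4: $-uf'(u)/f(u)$ is increasing in $u\ge0$ (with $f'$ at breakpoints given by the convention in F3). For $a,b>0$ with $ah_{\min}<b$ and $h>0$ define $$c_{ab}(h)=\frac{\int_{ah_{\min}}^{b}\int_{ah_{\min}}^{b}(xy)^{-\tau}\,r(ahx)\,r(ahy)\,r(xy)\,dx\,dy}{\Big[\int_{ah_{\min}}^{b}x^{-\tau}\,r(ahx)\,dx\Big]^2},$$ and let $c_{ab}(0)=\lim_{h\downarrow0}c_{ab}(h)$.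 Equivalently, for all $h\ge0$, $$c_{ab}(h)=\frac{\int_{ah_{\min}}^{b}\int_{ah_{\min}}^{b}(xy)^{2-\tau}f(ahx)f(ahy)f(xy)\,dx\,dy}{\Big(\int_{ah_{\min}}^{b}x^{1-\tau}f(ahx)\,dx\Big)^2}.$$ *)

(* Defs.v *)
From HB Require Import structures.
From mathcomp Require Import all_boot all_order all_algebra.
From mathcomp Require Import all_classical all_reals all_analysis.
Set Implicit Arguments.
Unset Strict Implicit.
Unset Printing Implicit Defensive.
Import Order.TTheory GRing.Theory Num.Theory.
Import numFieldNormedType.Exports.
Local Open Scope classical_set_scope.
Local Open Scope ring_scope.

(* A function on [0, +oo[ is represented by a map R -> R of which only the
   values at nonnegative arguments are ever constrained or used. *)

Definition r_of (R : realType) (f : R -> R) (u : R) : R := u * f u.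

Definition F1 (R : realType) (f : R -> R) : Prop :=
  [/\ f 0 = 1, {in `[0, +oo[ &, nonincreasing_fun f} & f u @[u --> +oo] --> 0].

Definition F2 (R : realType) (f : R -> R) : Prop :=
  {in `[0, +oo[ &, nondecreasing_fun (r_of f)} /\
  r_of f u @[u --> +oo] --> (1 : R).

(* Derivative at x of the restriction of f to D: increments e are taken with
   e + x in D only, so it is one-sided at an endpoint of an interval D. *)
Definition quotient_within (R : realType) (D : set R) (f : R -> R) (x : R) :=
  e^-1 * (f (e + x) - f x) @[e --> within [set e | D (e + x)] 0^'].

Definition derivable_within (R : realType) (D : set R) (f : R -> R) (x : R) :
  Prop := cvg (quotient_within D f x).

Definition derive_within (R : realType) (D : set R) (f : R -> R) (x : R) : R :=
  lim (quotient_within D f x).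

Definition twice_derivable_on (R : realType) (D : set R) (f : R -> R) : Prop :=
  forall x, D x ->
    derivable_within D f x /\ derivable_within D (derive_within D f) x.

(* us = [:: u_1; ...; u_K], without u_0 = 0; K = 0 is allowed. *)
Definition F3 (R : realType) (f : R -> R) (us : seq R) : Prop :=
  [/\ {within `[0, +oo[, continuous f},
      path <%R 0 us,
      forall k, (k < size us)%N ->
        twice_derivable_on `[nth 0 (0 :: us) k, nth 0 us k] f &
      twice_derivable_on `[last 0 us, +oo[ f].

(* f' on [0, +oo[, with the averaging convention at the breakpoints us. *)
Definition fprime (R : realType) (f : R -> R) (us : seq R) (u : R) : R :=
  if u == 0 then lim (f^`()%classic v @[v --> 0^'+])
  else if u \in us then
    2^-1 * lim (f^`()%classic v @[v --> u^'+]) + 2^-1 * lim (f^`()%classic v @[v --> u^'-])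
  else f^`()%classic u.

Definition F4 (R : realType) (f : R -> R) (us : seq R) : Prop :=
  {in `[0, +oo[ &, nondecreasing_fun (fun u => - u * fprime f us u / f u)}.

Definition cab_pos (R : realType) (tau hmin : R) (f : R -> R) (a b h : R) : R :=
  (\int[lebesgue_measure]_(y in `[a * hmin, b])
     \int[lebesgue_measure]_(x in `[a * hmin, b])
       ((x * y) `^ (- tau) * r_of f (a * h * x) * r_of f (a * h * y)
        * r_of f (x * y)))
  / (\int[lebesgue_measure]_(x in `[a * hmin, b])
       (x `^ (- tau) * r_of f (a * h * x))) ^+ 2.

(* At h = 0 the quotient cab_pos is 0 / 0 and is replaced by its limit. *)
Definition cab (R : realType) (tau hmin : R) (f : R -> R) (a b h : R) : R :=
  if h == 0 then lim (cab_pos tau hmin f a b t @[t --> 0^'+])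
  else cab_pos tau hmin f a b h.

(* Main.v *)
Require Import Defs.
From HB Require Import structures.
From mathcomp Require Import all_boot all_order all_algebra.
From mathcomp Require Import all_classical all_reals all_analysis.
From mathcomp Require Import ring.
Import Order.TTheory GRing.Theory Num.Theory.
Import numFieldNormedType.Exports.
Local Open Scope classical_set_scope.
Local Open Scope ring_scope.
Set Implicit Arguments.
Unset Strict Implicit.
Unset Printing Implicit Defensive.

(** Write p = a h and A = a hmin.  Up to the factor x^(-tau) r(p x), which plays
the part of an unnormalised density on [A, b], c_ab(h) is the mean of r(X Y)
for X and Y independent with that density.  Since r is nondecreasing, c_ab is
governed by how this density moves with p: the quotient of the densities for
p and q is, up to a constant, f(p x) / f(q x), and with
phi(u) = - u f'(u) / f(u) one has
  d/dx (f(p x) / f(q x)) = (f(p x) / f(q x)) / x * (phi(q x) - phi(p x)).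

If phi is nondecreasing and p <= q, the quotient is nondecreasing in x, so
passing from q to p shifts mass to the right and increases the mean of r(X Y).
The shift is expressed by Chebyshev's integral inequality ([chebyshev_le]),
applied once for each of the two variables ([product_mean_le]).  Breakpoints do
no harm because the quotient is continuous and they are finitely many
([ge0_derive1_le_off_seq]).  The value at h = 0 is the limit at 0 from the
right of a nonincreasing function bounded by 1, hence its supremum, so it
dominates all other values ([decreasing_lim_at_right0]).

Conversely, let phi(u) > phi(v) for some 0 < u < v outside the breakpoints.
The scale A is free: choose it so small that r is strictly increasing on
[A^2, b^2] (possible since r' -> 1 at 0, [r_of_strict_near0]), choose the two
values of h so that p A = u and q A = v, and b so close to A that the strict
inequality between the values of phi persists on [A, b].  There
f(q x) / f(p x) is strictly increasing, and the strict form of the comparison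
([product_mean_lt]) makes c_ab strictly larger at the larger h
([cab_increase]).  Thus phi is nondecreasing off the breakpoints.  At a
breakpoint the averaging convention puts phi halfway between its one-sided
limits, so monotonicity off the breakpoints extends to all of [0, +oo[
([F4_smoothP]). *)

(** * Chebyshev's integral inequality with a density quotient *)

Lemma within_continuousM (R : realType) (D : set R) (u v : R -> R) :
  {within D, continuous u} -> {within D, continuous v} ->
  {within D, continuous (fun x => u x * v x)}.
Proof. by move=> cu cv x; apply: continuousM; [exact: cu|exact: cv]. Qed.

Lemma within_continuousZ (R : realType) (D : set R) (c : R) (u : R -> R) :
  {within D, continuous u} -> {within D, continuous (fun x => c * u x)}.
Proof.
by move=> cu x; apply: continuousM; [exact: cst_continuous|exact: cu].
Qed.

Lemma itv_integrable (R : realType) (A b : R) (g : R -> R) :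
  {within `[A, b], continuous g} ->
  lebesgue_measure.-integrable `[A, b] (EFin \o g).
Proof.
by move=> cg; apply: continuous_compact_integrable => //; exact: segment_compact.
Qed.

(** The exceptional point x0 is there for integrands vanishing exactly where two
densities cross, such as those of the strict Chebyshev inequality. *)
Lemma Rintegral_gt0 (R : realType) (A b x0 : R) (g : R -> R) : A < b ->
  {within `[A, b], continuous g} ->
  (forall x, x \in `[A, b] -> x != x0 -> 0 < g x) ->
  (forall x, x \in `[A, b] -> 0 <= g x) ->
  0 < \int[lebesgue_measure]_(x in `[A, b]) g x.
Proof.
move=> Ab cg gpos gge0.
have ig := itv_integrable cg.
rewrite lt_neqAle Rintegral_ge0 ?andbT; last by move=> x xAb; exact: gge0.
apply/eqP => /esym int0.
have mD : measurable (`[A, b] : set R) by [].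
have {}int0 : (\int[lebesgue_measure]_(x in `[A, b]) `|(EFin \o g) x| = 0)%E.
  have -> : (\int[lebesgue_measure]_(x in `[A, b]) `|(EFin \o g) x| =
             \int[lebesgue_measure]_(x in `[A, b]) (g x)%:E)%E.
    apply: eq_integral => x; rewrite inE /= => xAb.
    by rewrite ger0_norm// gge0.
  rewrite -[LHS]fineK; last exact: integrable_fin_num.
  by rewrite -[0%E]/(0%:E) -int0.
have mg := measurable_int _ ig.
(* A vanishing integral makes g vanish almost everywhere, so [A, b] without x0
   is negligible. *)
have [N [mN N0 sN]] := (ae_eq_integral_abs lebesgue_measure mD mg).1 int0.
have : (lebesgue_measure (`[A, b] : set R) <= 0)%E.
  rewrite -[leRHS](adde0 0%E) -[X in (X + _)%E]N0 -(lebesgue_measure_set1 x0).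
  apply: le_trans (measureU2 _ _ _) => //.
  apply: le_measure; rewrite ?inE//; first exact: measurableU.
  move=> x /= xAb; have [->|xx0] := eqVneq x x0; first by right.
  left; apply: sN => /= /(_ xAb) /eqP; rewrite eqe => /eqP gx0.
  by have := gpos x xAb xx0; rewrite gx0 ltxx.
by rewrite lebesgue_measure_itv /= lte_fin Ab -EFinD lee_fin subr_le0 leNgt Ab.
Qed.

(** The quotient of the integrals is a weighted mean of the quotient w2 / w1, so
the latter attains it by the intermediate value theorem.  The point x0 is where
the two normalised densities cross. *)
Lemma Rintegral_mean_ratio (R : realType) (A b : R) (w1 w2 : R -> R) : A < b ->
  {within `[A, b], continuous w1} -> {within `[A, b], continuous w2} ->
  (forall x, x \in `[A, b] -> 0 < w1 x) ->
  {in `[A, b] &, {homo (fun x => w2 x / w1 x) : x y / x <= y}} ->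
  exists2 x0, x0 \in `[A, b] & w2 x0 / w1 x0 =
    (\int[lebesgue_measure]_(x in `[A, b]) w2 x) /
    (\int[lebesgue_measure]_(x in `[A, b]) w1 x).
Proof.
move=> Ab c1 c2 w1gt0 mono.
have i1 := itv_integrable c1; have i2 := itv_integrable c2.
have Ain : A \in `[A, b] by rewrite in_itv/= lexx ltW.
have bin : b \in `[A, b] by rewrite in_itv/= lexx ltW.
have I1 : 0 < \int[lebesgue_measure]_(x in `[A, b]) w1 x.
  by apply: (@Rintegral_gt0 _ _ _ A) => // x xin;
    [move=> _|apply/ltW]; exact: w1gt0.
have cr : {within `[A, b], continuous (fun x => w2 x / w1 x)}.
  apply/subspace_continuousP => x xin.
  apply: cvgM; first by move/subspace_continuousP : c2; exact.
  apply: cvgV; first by rewrite gt_eqF// w1gt0.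
  by move/subspace_continuousP : c1; exact.
have le_int (u v : R -> R) : {within `[A, b], continuous u} ->
    {within `[A, b], continuous v} ->
    (forall x, x \in `[A, b] -> u x <= v x) ->
    \int[lebesgue_measure]_(x in `[A, b]) u x <=
    \int[lebesgue_measure]_(x in `[A, b]) v x.
  by move=> cu cv uv; apply: le_Rintegral => //; exact: itv_integrable.
apply: IVT => //; first exact: ltW.
rewrite (min_idPl _) ?(max_idPr _); try by apply: mono => //; exact: ltW.
rewrite ler_pdivlMr// ler_pdivrMr// -!RintegralZl//.
apply/andP; split; apply: le_int => //;
  try exact: within_continuousZ; move=> x xin.
  rewrite -ler_pdivlMr ?w1gt0//; apply: mono => //.
  by move: xin; rewrite in_itv => /andP[].
rewrite -ler_pdivrMr ?w1gt0//; apply: mono => //.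
by move: xin; rewrite in_itv => /andP[].
Qed.

Section chebyshev.
Variables (R : realType) (A b : R) (w1 w2 K : R -> R).
Hypotheses (Ab : A < b) (c1 : {within `[A, b], continuous w1})
  (c2 : {within `[A, b], continuous w2}) (cK : {within `[A, b], continuous K})
  (w1gt0 : forall x, x \in `[A, b] -> 0 < w1 x).
Notation mu := (@lebesgue_measure R).

(** When l is the quotient of the integrals the last term vanishes for every k,
so K may be recentred at its value at the crossing point. *)
Lemma Rintegral_recenter (k l : R) :
  \int[mu]_(x in `[A, b]) ((w2 x - l * w1 x) * (K x - k)) =
  \int[mu]_(x in `[A, b]) (w2 x * K x) -
  l * \int[mu]_(x in `[A, b]) (w1 x * K x) -
  k * (\int[mu]_(x in `[A, b]) w2 x - l * \int[mu]_(x in `[A, b]) w1 x).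
Proof.
rewrite -RintegralZl//; last by apply: itv_integrable; exact: within_continuousM.
rewrite -RintegralB//; try by apply: itv_integrable;
  do ?[exact: within_continuousM|apply: within_continuousZ].
rewrite -[l * \int[_]_(_ in _) w1 _]RintegralZl//; last exact: itv_integrable.
rewrite -RintegralB//; try by apply: itv_integrable => //; exact: within_continuousZ.
rewrite -RintegralZl//; last first.
  apply: itv_integrable; apply: within_continuousB => //.
  exact: within_continuousZ.
rewrite -RintegralB//; try by apply: itv_integrable;
  do ?[exact: within_continuousM|apply: within_continuousZ
      |apply: within_continuousB].
by apply: eq_Rintegral => x _; ring.
Qed.

(** Let x0 be the crossing point of w2 and l w1, where l is the quotient of the
integrals.  Both w2 - l w1 and K - K x0 are nonpositive to the left of x0 and
nonnegative to its right, so their product has a nonnegative integral, which is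
the claim after recentring. *)
Lemma chebyshev_le :
  {in `[A, b] &, {homo (fun x => w2 x / w1 x) : x y / x <= y}} ->
  {in `[A, b] &, {homo K : x y / x <= y}} ->
  (\int[mu]_(x in `[A, b]) (w1 x * K x)) * \int[mu]_(x in `[A, b]) w2 x <=
  (\int[mu]_(x in `[A, b]) (w2 x * K x)) * \int[mu]_(x in `[A, b]) w1 x.
Proof.
move=> mono monoK.
have I1 : 0 < \int[mu]_(x in `[A, b]) w1 x.
  by apply: (@Rintegral_gt0 _ _ _ A) => // x xin;
    [move=> _|apply/ltW]; exact: w1gt0.
have [x0 x0in eqx0] := Rintegral_mean_ratio Ab c1 c2 w1gt0 mono.
rewrite -ler_pdivrMr// -mulrA mulrC -subr_ge0.
suff : 0 <= \int[mu]_(x in `[A, b]) ((w2 x - w2 x0 / w1 x0 * w1 x) * (K x - K x0)).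
  by rewrite Rintegral_recenter eqx0 divfK ?gt_eqF// subrr mulr0 subr0.
apply: Rintegral_ge0 => x xin.
have [xx0|x0x] := leP x x0.
  apply: mulr_le0; rewrite subr_le0; last exact: monoK.
  by rewrite -ler_pdivrMr ?w1gt0//; exact: mono.
apply: mulr_ge0; rewrite subr_ge0; last by apply: monoK => //; exact: ltW.
by rewrite -ler_pdivlMr ?w1gt0//; apply: mono => //; exact: ltW.
Qed.

Lemma chebyshev_lt :
  {in `[A, b] &, {homo (fun x => w2 x / w1 x) : x y / x < y}} ->
  {in `[A, b] &, {homo K : x y / x < y}} ->
  (\int[mu]_(x in `[A, b]) (w1 x * K x)) * \int[mu]_(x in `[A, b]) w2 x <
  (\int[mu]_(x in `[A, b]) (w2 x * K x)) * \int[mu]_(x in `[A, b]) w1 x.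
Proof.
move=> mono monoK.
have I1 : 0 < \int[mu]_(x in `[A, b]) w1 x.
  by apply: (@Rintegral_gt0 _ _ _ A) => // x xin;
    [move=> _|apply/ltW]; exact: w1gt0.
have [x0 x0in eqx0] := Rintegral_mean_ratio Ab c1 c2 w1gt0
  (ltac:(move=> x y xin yin; rewrite le_eqVlt => /predU1P[->//
                  |/mono] /(_ xin yin)/ltW //)).
rewrite -ltr_pdivrMr// -mulrA mulrC -subr_gt0.
suff : 0 < \int[mu]_(x in `[A, b]) ((w2 x - w2 x0 / w1 x0 * w1 x) * (K x - K x0)).
  by rewrite Rintegral_recenter eqx0 divfK ?gt_eqF// subrr mulr0 subr0.
have gpos x : x \in `[A, b] -> x != x0 ->
    0 < (w2 x - w2 x0 / w1 x0 * w1 x) * (K x - K x0).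
  move=> xin; rewrite neq_lt => /orP[xx0|x0x].
    rewrite -mulrNN mulr_gt0// oppr_gt0 subr_lt0 ?monoK//.
    by rewrite -ltr_pdivrMr ?w1gt0//; exact: mono.
  rewrite mulr_gt0// subr_gt0 ?monoK//.
  by rewrite -ltr_pdivlMr ?w1gt0//; exact: mono.
apply: (@Rintegral_gt0 _ _ _ x0) => //.
  apply: within_continuousM; apply: within_continuousB => //.
    exact: within_continuousZ.
  by move=> x; exact: cst_continuous.
move=> x xin; have [->|xx0] := eqVneq x x0; first by rewrite subrr mulr0.
by apply/ltW/gpos.
Qed.

End chebyshev.

(** * Means of a kernel of the product of two independent variables *)

Lemma lipschitz_within_continuous (R : realType) (D : set R) (M : R) (g : R -> R) :
  0 <= M -> (forall x y, D x -> D y -> `|g x - g y| <= M * `|x - y|) ->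
  {within D, continuous g}.
Proof.
move=> M0 lip; apply/subspace_continuousP => x Dx.
apply/cvgrPdist_le => e e0; near=> y.
have Dy : D y by near: y; apply: withinT.
apply: le_trans (lip _ _ Dx Dy) _.
apply: (@le_trans _ _ ((M + 1) * `|x - y|)).
  by rewrite ler_wpM2r// lerDl.
rewrite mulrC -ler_pdivlMr; last by rewrite ltr_wpDl.
near: y; apply: (@cvgr_dist_le _ _ _ _ _ (fun y : R => y)).
  exact: cvg_within.
by rewrite divr_gt0// ltr_wpDl.
Unshelve. all: by end_near. Qed.

(** Replacing one density at a time: M is the mixed double integral, with one
variable weighted by each density. *)
Lemma ratio_chain_le (R : realFieldType) (N1 M N2 I1 I2 : R) :
  0 < I1 -> 0 < I2 -> N1 * I2 <= M * I1 -> M * I2 <= N2 * I1 ->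
  N1 / I1 ^+ 2 <= N2 / I2 ^+ 2.
Proof.
move=> I1_gt0 I2_gt0 NM MN.
rewrite ler_pdivrMr ?exprn_gt0// mulrAC ler_pdivlMr ?exprn_gt0// !expr2 !mulrA.
apply: (@le_trans _ _ (M * I1 * I2)); first by rewrite ler_pM2r.
by rewrite mulrAC ler_pM2r.
Qed.

Lemma ratio_chain_lt (R : realFieldType) (N1 M N2 I1 I2 : R) :
  0 < I1 -> 0 < I2 -> N1 * I2 <= M * I1 -> M * I2 < N2 * I1 ->
  N1 / I1 ^+ 2 < N2 / I2 ^+ 2.
Proof.
move=> I1_gt0 I2_gt0 NM MN.
rewrite ltr_pdivrMr ?exprn_gt0// mulrAC ltr_pdivlMr ?exprn_gt0// !expr2 !mulrA.
apply: (@le_lt_trans _ _ (M * I1 * I2)); first by rewrite ler_pM2r.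
by rewrite mulrAC ltr_pM2r.
Qed.

Section product_mean.
Variables (R : realType) (A b : R) (k : R -> R).
Hypotheses (A0 : 0 < A) (Ab : A < b).
Hypothesis k_lip :
  forall s t : R, 0 <= s -> 0 <= t -> `|k s - k t| <= `|s - t|.
Hypothesis k_mono : {in `[0, +oo[ &, {homo k : s t / s <= t}}.
Notation mu := (@lebesgue_measure R).
Implicit Types w : R -> R.

(** Without normalisation: the mean of k(X y) for X of density w. *)
Definition inner_mean w (y : R) : R := \int[mu]_(x in `[A, b]) (w x * k (x * y)).

(** The mean of k(X Y) for X and Y independent of density w. *)
Definition product_mean w : R :=
  (\int[mu]_(y in `[A, b]) (w y * inner_mean w y)) /
  (\int[mu]_(x in `[A, b]) w x) ^+ 2.

Let itv_gt0 x : x \in `[A, b] -> 0 < x.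
Proof. by rewrite in_itv /= => /andP[/(lt_le_trans A0)]. Qed.

Let itv_ge0 x : x \in `[A, b] -> 0 <= x.
Proof. by move/itv_gt0/ltW. Qed.

Lemma kernel_continuous y : y \in `[A, b] ->
  {within `[A, b], continuous (fun x => k (x * y))}.
Proof.
move=> yin; apply: (@lipschitz_within_continuous _ _ y); first exact: itv_ge0.
move=> x z xin zin; apply: le_trans (k_lip _ _) _; rewrite ?mulr_ge0 ?itv_ge0//.
by rewrite -mulrBl normrM mulrC (ger0_norm (itv_ge0 yin)).
Qed.

Lemma kernel_homo y : y \in `[A, b] ->
  {in `[A, b] &, {homo (fun x => k (x * y)) : x z / x <= z}}.
Proof.
move=> yin x z xin zin xz; apply: k_mono.
- by rewrite in_itv/= andbT mulr_ge0 ?itv_ge0.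
- by rewrite in_itv/= andbT mulr_ge0 ?itv_ge0.
- by rewrite ler_wpM2r ?itv_ge0.
Qed.

Section one_weight.
Variable w : R -> R.
Hypotheses (cw : {within `[A, b], continuous w})
  (w0 : forall x, x \in `[A, b] -> 0 < w x).

Lemma weight_gt0 : 0 < \int[mu]_(x in `[A, b]) w x.
Proof.
by apply: (@Rintegral_gt0 _ _ _ A) => // x xin; [move=> _|apply/ltW]; exact: w0.
Qed.

Lemma inner_mean_integrable y : y \in `[A, b] ->
  mu.-integrable `[A, b] (EFin \o (fun x => w x * k (x * y))).
Proof.
move=> yin; apply: itv_integrable; apply: within_continuousM => //.
exact: kernel_continuous.
Qed.

Lemma inner_mean_homo :
  {in `[A, b] &, {homo inner_mean w : y z / y <= z}}.
Proof.
move=> y z yin zin yz; apply: le_Rintegral => //; try exact: inner_mean_integrable.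
move=> x xin; rewrite ler_wpM2l//; first exact/ltW/w0.
by rewrite ![x * _]mulrC; exact: kernel_homo.
Qed.

(** The Lipschitz bound of k passes through the integral; continuity makes the
outer integrand integrable. *)
Lemma inner_mean_continuous : {within `[A, b], continuous inner_mean w}.
Proof.
have cid : {within `[A, b], continuous (fun x : R => x)}.
  by apply: continuous_subspaceT => x; exact: cvg_id.
have ci : mu.-integrable `[A, b] (EFin \o (fun x => w x * x)).
  by apply: itv_integrable; exact: within_continuousM.
apply: (@lipschitz_within_continuous _ _ (\int[mu]_(x in `[A, b]) (w x * x))).
  by apply: Rintegral_ge0 => x xin; apply: mulr_ge0; [exact/ltW/w0|exact: itv_ge0].
move=> y z yin zin; rewrite /inner_mean.
rewrite -RintegralB//; try exact: inner_mean_integrable.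
have iB : mu.-integrable `[A, b]
    (EFin \o (fun x => w x * k (x * y) - w x * k (x * z))).
  apply: itv_integrable; apply: within_continuousB;
    by apply: within_continuousM => //; exact: kernel_continuous.
apply: le_trans (le_normr_Rintegral _ iB) _ => //.
rewrite -RintegralZr//; apply: le_Rintegral => //.
- exact: integrable_norm iB.
- apply: itv_integrable; apply: within_continuousM.
    exact: within_continuousM.
  by move=> x; exact: cst_continuous.
- move=> x xin; rewrite -mulrBr normrM gtr0_norm ?w0// -mulrA ler_wpM2l//.
    exact/ltW/w0.
  apply: le_trans (k_lip _ _) _; rewrite ?mulr_ge0 ?itv_ge0//.
  by rewrite -mulrBr normrM (ger0_norm (itv_ge0 xin)).
Qed.

Lemma product_mean_le1 : (forall s : R, 0 <= s -> k s <= 1) -> product_mean w <= 1.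
Proof.
move=> k1; have I0 := weight_gt0.
rewrite /product_mean ler_pdivrMr ?exprn_gt0// mul1r expr2 -RintegralZr//; last first.
  exact: itv_integrable.
apply: le_Rintegral => //.
- by apply: itv_integrable; apply: within_continuousM => //; exact: inner_mean_continuous.
- apply: itv_integrable; apply: within_continuousM => //.
  by move=> x; exact: cst_continuous.
move=> y yin; rewrite ler_wpM2l//; first exact/ltW/w0.
apply: le_Rintegral => //; [exact: inner_mean_integrable|exact: itv_integrable|].
move=> x xin; rewrite -[leRHS]mulr1 ler_wpM2l//; first exact/ltW/w0.
by apply: k1; rewrite mulr_ge0 ?itv_ge0.
Qed.

End one_weight.

Section two_weights.
Variables (w1 w2 : R -> R).
Hypotheses (c1 : {within `[A, b], continuous w1})
  (c2 : {within `[A, b], continuous w2})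
  (w1gt0 : forall x, x \in `[A, b] -> 0 < w1 x)
  (w2gt0 : forall x, x \in `[A, b] -> 0 < w2 x).

Let mixed_mean := \int[mu]_(y in `[A, b]) (w2 y * inner_mean w1 y).

Let outer_le : {in `[A, b] &, {homo (fun x => w2 x / w1 x) : x y / x <= y}} ->
  \int[mu]_(y in `[A, b]) (w1 y * inner_mean w1 y) * \int[mu]_(x in `[A, b]) w2 x
  <= mixed_mean * \int[mu]_(x in `[A, b]) w1 x.
Proof.
move=> mono; apply: chebyshev_le => //.
  exact: inner_mean_continuous.
exact: inner_mean_homo.
Qed.

Let cW w (i : R -> R) (c : R) : {within `[A, b], continuous w} ->
  (forall x, x \in `[A, b] -> 0 < w x) -> {within `[A, b], continuous i} ->
  {within `[A, b], continuous (fun y => i y * (inner_mean w y * c))}.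
Proof.
move=> cw w0 ci; apply: within_continuousM => //.
apply: within_continuousM; first exact: inner_mean_continuous.
by move=> y; exact: cst_continuous.
Qed.

Let inner_intE w (c : R) : {within `[A, b], continuous w} ->
  (forall x, x \in `[A, b] -> 0 < w x) ->
  \int[mu]_(y in `[A, b]) (w2 y * inner_mean w y) * c =
  \int[mu]_(y in `[A, b]) (w2 y * (inner_mean w y * c)).
Proof.
move=> cw w0; rewrite -RintegralZr//.
  by apply: eq_Rintegral => y _; rewrite mulrA.
apply: itv_integrable; apply: within_continuousM => //.
exact: inner_mean_continuous.
Qed.

(** Chebyshev's inequality for the outer variable replaces w1 by w2 there, the
inner mean being nondecreasing; for the inner variable it holds for each value
of the outer one and is then integrated. *)
Lemma product_mean_le :
  {in `[A, b] &, {homo (fun x => w2 x / w1 x) : x y / x <= y}} ->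
  product_mean w1 <= product_mean w2.
Proof.
move=> mono; have I1 := weight_gt0 c1 w1gt0; have I2 := weight_gt0 c2 w2gt0.
apply: (ratio_chain_le I1 I2 (outer_le mono)); rewrite !inner_intE//.
apply: le_Rintegral => //; try by apply: itv_integrable; exact: cW.
move=> y yin; rewrite ler_wpM2l//; first exact/ltW/w2gt0.
apply: chebyshev_le => //; first exact: kernel_continuous.
exact: kernel_homo.
Qed.

(** Strictness comes from the inner replacement, where the kernel itself, rather
than its mean, is the increasing factor. *)
Lemma product_mean_lt :
  {in `[A, b] &, {homo (fun x => w2 x / w1 x) : x y / x < y}} ->
  {in `[A * A, b * b] &, {homo k : s t / s < t}} ->
  product_mean w1 < product_mean w2.
Proof.
move=> mono k_smono.
have I1 := weight_gt0 c1 w1gt0; have I2 := weight_gt0 c2 w2gt0.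
apply: (ratio_chain_lt I1 I2); first apply: outer_le.
  by move=> x y xin yin; rewrite le_eqVlt => /predU1P[->//|xy]; exact/ltW/mono.
rewrite !inner_intE// -subr_gt0 -RintegralB//;
  try by apply: itv_integrable; exact: cW.
have pos y : y \in `[A, b] ->
  0 < w2 y * (inner_mean w2 y * \int[mu]_(x in `[A, b]) w1 x) -
      w2 y * (inner_mean w1 y * \int[mu]_(x in `[A, b]) w2 x).
  move=> yin; rewrite -mulrBr mulr_gt0 ?w2gt0// subr_gt0.
  apply: chebyshev_lt => //; first exact: kernel_continuous.
  move=> x z xin zin xz.
  have sub u : u \in `[A, b] -> u * y \in `[A * A, b * b].
    move=> uin; rewrite in_itv /=; move: (uin) (yin).
    rewrite !in_itv/= => /andP[Au ub] /andP[Ay yb].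
    by apply/andP; split; apply: ler_pM => //; solve [exact: itv_ge0|exact: ltW].
  by apply: k_smono; rewrite ?sub// ltr_pM2r// itv_gt0.
apply: (@Rintegral_gt0 _ _ _ A) => //.
- by apply: within_continuousB; exact: cW.
- by move=> x xin _; exact: pos.
- by move=> x xin; exact/ltW/pos.
Qed.

End two_weights.

End product_mean.

(** * One-sided limits of the derivative of a piecewise smooth function *)

Lemma within_full (T : Type) (F : set_system T) (S : set T) : Filter F ->
  F S -> within S F = F.
Proof.
move=> FF FS; rewrite eqEsubset; split=> P; rewrite /within /= => FP.
  by apply: filterS2 FS FP => x Sx; exact.
by apply: filterS FP.
Qed.

Lemma nbhs_shift_dnbhs (R : realType) (D : set R) (v : R) :
  nbhs v D -> \forall e \near 0^', D (e + v).
Proof.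
move=> vD; apply: nbhs_dnbhs.
have : (fun e : R => e + v) @ (0 : R) --> v.
  rewrite -[X in _ --> X]add0r; apply: cvgD; [exact: cvg_id|exact: cvg_cst].
exact.
Qed.

Lemma dnbhs_shift (R : realType) (u : R) (P : set R) :
  0^' P -> \forall v \near u^', P (v - u).
Proof.
rewrite /dnbhs !near_withinE => P0.
have : v - u @[v --> u] --> (0 : R).
  by rewrite -[X in _ --> X](subrr u); apply: cvgB; [exact: cvg_id|exact: cvg_cst].
move=> /(_ _ P0) Pu; have {}Pu : \forall v \near u, v - u != 0 -> P (v - u) := Pu.
by apply: filterS Pu => v Pv vu; apply: Pv; rewrite subr_eq0.
Qed.

Lemma interior_derive (R : realType) (D : set R) (f : R -> R) (v : R) :
  nbhs v D -> derivable_within D f v ->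
  derivable f v 1 /\ derive_within D f v = derive1 f v.
Proof.
move=> vD; rewrite /derivable_within /derive_within /quotient_within.
rewrite within_full; last exact: nbhs_shift_dnbhs.
move=> cv; split; last by [].
rewrite /derivable (_ : (fun h : R => _) = (fun e => e^-1 * (f (e + v) - f v)))//.
by apply/funext => h /=; rewrite [h%:A]mulr1.
Qed.

(** Differentiability of g relative to D gives continuity relative to D.  The
filter G stands for approach to u from the left or from the right. *)
Lemma derive_within_cvg (R : realType) (D : set R) (g : R -> R) (u : R)
    (G : set_system R) : Filter G -> derivable_within D g u ->
  G --> u^' -> (\forall v \near G, D v) -> g v @[v --> G] --> g u.
Proof.
move=> FG dg Gu GD.
(* Undoing the division in the difference quotient: e times the quotient tends
   to 0, which is g (e + u) - g u -> 0. *)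
pose F := within [set e | D (e + u)] (0^' : set_system R).
have F0 : e @[e --> F] --> (0 : R).
  by apply: cvg_within_filter; apply: cvg_within_filter; exact: cvg_id.
have : e * (e^-1 * (g (e + u) - g u)) + g u @[e --> F] --> 
   0 * lim (e^-1 * (g (e + u) - g u) @[e --> F]) + g u.
  apply: cvgD; last exact: cvg_cst.
  by apply: cvgM.
rewrite mul0r add0r => Fg.
have GF : v - u @[v --> G] --> F.
  move=> P /=; rewrite /F /within /= => FP.
  have GP : \forall v \near G, D (v - u + u) -> P (v - u).
    exact/Gu/(@dnbhs_shift _ u (fun e => D (e + u) -> P e)).
  have : \forall v \near G, P (v - u).
    by apply: filterS2 GP GD => v GPv Dv; apply: GPv; rewrite subrK.
  exact.
have := cvg_comp _ _ GF Fg.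
apply: cvg_trans; apply: near_eq_cvg.
have uu : \forall v \near u^', v != u by rewrite /dnbhs near_withinE; exact: filterE.
have : \forall v \near G, v != u by exact: Gu uu.
apply: filterS => v vu /=; rewrite subrK mulVKf ?subrK//.
by rewrite subr_eq0.
Qed.

(** In the interior of D the derivative relative to D is the ordinary one, so the
ordinary derivative inherits the continuity of the relative one, up to the
endpoints. *)
Lemma derive1_cvg (R : realType) (D : set R) (f : R -> R) (u : R)
    (G : set_system R) : Filter G -> twice_derivable_on D f -> D u ->
  G --> u^' -> (\forall v \near G, nbhs v D) ->
  derive1 f v @[v --> G] --> derive_within D f u /\
  \forall v \near G, derivable f v 1.
Proof.
move=> FG fD Du Gu GD.
have eqd : \forall v \near G, derivable f v 1 /\ derive_within D f v = derive1 f v.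
  apply: filterS GD => v vD; apply: interior_derive => //.
  by have [] := fD v (nbhs_singleton vD).
split; last by apply: filterS eqd => v [].
apply: cvg_trans (derive_within_cvg FG (fD u Du).2 Gu _); last first.
  by apply: filterS GD => v /nbhs_singleton.
by apply: near_eq_cvg; apply: filterS eqd => v [].
Qed.

(** The starting point c, which is 0 in the end, is a parameter so that
induction can remove the leftmost piece. *)
Definition pieces (R : realType) (f : R -> R) (c : R) (us : seq R) : Prop :=
  (forall k, (k < size us)%N ->
     twice_derivable_on `[nth 0 (c :: us) k, nth 0 us k] f) /\
  twice_derivable_on `[last c us, +oo[ f.

Lemma pieces_cons (R : realType) (f : R -> R) (c s : R) (us : seq R) :
  pieces f c (s :: us) -> twice_derivable_on `[c, s] f /\ pieces f s us.
Proof.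
move=> [fk fl]; split; first exact: (fk 0%N).
by split => // k kus; exact: (fk k.+1).
Qed.

Lemma piece_right (R : realType) (f : R -> R) (us : seq R) (c u : R) :
  path <%R c us -> pieces f c us -> c <= u ->
  exists D d, [/\ twice_derivable_on D f, u < d & `[u, d] `<=` D].
Proof.
elim: us c => [|s us IH] c /=.
  move=> _ [_ fl] cu; exists `[c, +oo[%classic, (u + 1); split=> //.
    by rewrite ltrDl.
  by move=> x /=; rewrite !in_itv/= andbT => /andP[/(le_trans cu)].
move=> /andP[cs sus] /pieces_cons[fcs fus] cu.
have [us_|su] := ltP u s; last exact: IH su.
exists `[c, s]%classic, s; split => //.
by move=> x /=; rewrite !in_itv/= => /andP[/(le_trans cu) -> ->].
Qed.

Lemma piece_left (R : realType) (f : R -> R) (us : seq R) (c u : R) :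
  path <%R c us -> pieces f c us -> c < u ->
  exists D d, [/\ twice_derivable_on D f, d < u & `[d, u] `<=` D].
Proof.
elim: us c => [|s us IH] c /=.
  move=> _ [_ fl] cu; exists `[c, +oo[%classic, c; split=> //.
  by move=> x /=; rewrite !in_itv/= andbT => /andP[].
move=> /andP[cs sus] /pieces_cons[fcs fus] cu.
have [us_|su] := leP u s; last exact: IH su.
exists `[c, s]%classic, c; split => //.
by move=> x /=; rewrite !in_itv/= => /andP[-> /le_trans]; exact.
Qed.

Lemma piece_interior (R : realType) (f : R -> R) (us : seq R) (c u : R) :
  path <%R c us -> pieces f c us -> c < u -> u \notin us ->
  exists2 D, twice_derivable_on D f & nbhs u D.
Proof.
elim: us c => [|s us IH] c /=.
  move=> _ [_ fl] cu _; exists `[c, +oo[%classic => //.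
  apply: filterS (lt_nbhsr cu) => x /= cx.
  by rewrite in_itv/= andbT ltW.
move=> /andP[cs sus] /pieces_cons[fcs fus] cu.
rewrite inE negb_or neq_lt => /andP[/orP[us_|su] uus]; last exact: IH su _.
exists `[c, s]%classic => //; apply: filterS (near_in_itvoo (_ : u \in `]c, s[)).
  exact: subset_itv_oo_cc.
by rewrite in_itv/= cu.
Qed.

Section breakpoints.
Variables (R : realType) (f : R -> R) (us : seq R).
Hypotheses (us_sorted : path <%R 0 us) (f_pieces : pieces f 0 us).

Lemma derive1_cvg_right u : 0 <= u ->
  cvg (derive1 f v @[v --> u^'+]) /\ \forall v \near u^'+, derivable f v 1.
Proof.
move=> u0; have [D [d [fD ud udD]]] := piece_right us_sorted f_pieces u0.
have [|||l df] := @derive1_cvg _ D f u u^'+ _ fD.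
- by apply: udD; rewrite /= in_itv/= lexx ltW.
- by apply: within_subset => r /=; apply: contraTneq => ->; rewrite ltxx.
- near=> v; apply: filterS udD _.
  apply: filterS (near_in_itvoo (_ : v \in `]_, _[)).
    exact: subset_itv_oo_cc.
  by rewrite in_itv/=; apply/andP; split; near: v;
    [exact: nbhs_right_gt|exact: nbhs_right_lt].
by split => //; apply/cvg_ex; eexists; exact: l.
Unshelve. all: by end_near. Qed.

Lemma derive1_cvg_left u : 0 < u -> cvg (derive1 f v @[v --> u^'-]).
Proof.
move=> u0; have [D [d [fD ud udD]]] := piece_left us_sorted f_pieces u0.
have [|||l df] := @derive1_cvg _ D f u u^'- _ fD.
- by apply: udD; rewrite /= in_itv/= lexx ltW.
- by apply: within_subset => r /=; apply: contraTneq => ->; rewrite ltxx.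
- near=> v; apply: filterS udD _.
  apply: filterS (near_in_itvoo (_ : v \in `]_, _[)).
    exact: subset_itv_oo_cc.
  by rewrite in_itv/=; apply/andP; split; near: v;
    [exact: nbhs_left_gt|exact: nbhs_left_lt].
by apply/cvg_ex; eexists; exact: l.
Unshelve. all: by end_near. Qed.

Lemma derivable_off_breakpoints u : 0 < u -> u \notin us -> derivable f u 1.
Proof.
move=> u0 uus; have [D fD uD] := piece_interior us_sorted f_pieces u0 uus.
have [] := interior_derive uD (fD u (nbhs_singleton uD)).1; exact.
Qed.

Lemma derive1_right_continuous u : 0 < u -> u \notin us ->
  derive1 f v @[v --> u^'+] --> derive1 f u.
Proof.
move=> u0 uus; have [D fD uD] := piece_interior us_sorted f_pieces u0 uus.
have Du := nbhs_singleton uD.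
have [_ <-] := interior_derive uD (fD u Du).1.
have [||//] := @derive1_cvg _ D f u u^'+ _ fD Du.
- by apply: within_subset => r /=; apply: contraTneq => ->; rewrite ltxx.
- by apply: cvg_within; apply: nbhs_interior.
Qed.

End breakpoints.

(** * Monotonicity of functions differentiable off a finite set *)

Lemma at_right_ex (R : realType) (u : R) (P : set R) :
  (\forall v \near u^'+, P v) -> exists2 d, u < d & forall v, u < v < d -> P v.
Proof.
rewrite /at_right near_withinE => -[e /= e0 eP]; exists (u + e); first by rewrite ltrDl.
move=> v /andP[uv vd]; apply: eP => //=.
by rewrite distrC gtr0_norm ?subr_gt0// ltrBlDl.
Qed.

Lemma dnbhs_notin (R : realType) (u : R) (s : seq R) : \forall v \near u^', v \notin s.
Proof.
elim: s => [|x s IH]; first exact: filterE.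
have neq : \forall v \near u^', v != x.
  have [->|ux] := eqVneq x u.
    by rewrite /dnbhs near_withinE; exact: filterE.
  apply: nbhs_dnbhs; apply: open_nbhs_nbhs; split; last by rewrite /= eq_sym.
  exact: open_neq.
by apply: filterS2 neq IH => v vx vs; rewrite inE negb_or vx.
Qed.

(** The exceptional points are removed one by one: such a point inside ]x, y[
splits the interval in two, and continuity at it glues the two inequalities. *)
Lemma ge0_derive1_le_off_seq (R : realType) (s : seq R) (g : R -> R) (x y : R) :
  x <= y -> {within `[x, y], continuous g} ->
  (forall z, z \in `]x, y[ -> z \notin s ->
     derivable g z 1 /\ 0 <= derive1 g z) ->
  g x <= g y.
Proof.
elim: s x y => [|c s IH] x y xy cg dg.
  apply: (@ger0_derive1_le_cc _ g x y) => //; try by move=> z /dg[].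
  - by rewrite in_itv/= lexx.
  - by rewrite in_itv/= lexx andbT.
have sub x' y' : x <= x' -> y' <= y -> x' <= y' ->
    c \notin `]x', y'[ -> g x' <= g y'.
  move=> xx' yy' x'y' cn; apply: IH => //.
    by apply: continuous_subspaceW cg; apply: subset_itv; rewrite bnd_simp.
  move=> z zin zs; apply: dg; last first.
    by rewrite inE negb_or zs andbT; apply: contraNneq cn => <-.
  by move: z zin {zs}; apply: subset_itv; rewrite bnd_simp.
have [cin|cout] := boolP (c \in `]x, y[); last exact: sub.
move: (cin); rewrite in_itv/= => /andP[/ltW xc /ltW cy].
by apply: (@le_trans _ _ (g c)); apply: sub => //; rewrite in_itv/= ltxx ?andbF.
Qed.

(** * The densities x^(-tau) r(p x) and their quotients *)

Section profile.
Variables (R : realType) (f : R -> R).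
Hypothesis hf : forall u : R, 0 <= u -> 0 < f u <= 1.
Hypotheses (hF1 : F1 f) (hF2 : F2 f).
Hypothesis f_cont : {within `[0, +oo[, continuous f}.

Let f_gt0 u : 0 <= u -> 0 < f u.
Proof. by move=> /hf/andP[]. Qed.

Lemma r_of_homo : {in `[0, +oo[ &, {homo r_of f : s t / s <= t}}.
Proof. exact: hF2.1. Qed.

(** For s <= t the increment of r is nonnegative, and at most (t - s) f(s)
because f is nonincreasing. *)
Lemma r_of_lipschitz (s t : R) : 0 <= s -> 0 <= t ->
  `|r_of f s - r_of f t| <= `|s - t|.
Proof.
wlog st : s t / s <= t => [H s0 t0|s0 t0].
  have [st|/ltW ts] := leP s t; first exact: H.
  by rewrite distrC [leRHS]distrC; exact: H.
have sin : s \in `[0, +oo[ by rewrite in_itv/= s0.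
have tin : t \in `[0, +oo[ by rewrite in_itv/= t0.
rewrite distrC ger0_norm ?subr_ge0; last exact: r_of_homo.
rewrite distrC ger0_norm ?subr_ge0// /r_of.
have [_ fmono _] := hF1; have fts := fmono _ _ sin tin st.
apply: (@le_trans _ _ ((t - s) * f s)).
  by rewrite mulrBl lerD2r ler_wpM2l.
by rewrite ler_piMr ?subr_ge0//; have /andP[] := hf s0.
Qed.

Lemma r_of_le1 (s : R) : 0 <= s -> r_of f s <= 1.
Proof.
move=> s0; have [mono cvg1] := hF2.
have <- : lim (r_of f u @[u --> +oo]) = 1 by exact: cvg_lim.
apply: limr_ge; first by apply/cvg_ex; exists 1.
near=> u; have su : s <= u by near: u; apply: nbhs_pinfty_ge; exact: num_real.
by apply: mono => //; rewrite in_itv/= andbT// (le_trans s0).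
Unshelve. all: by end_near. Qed.

Lemma profile_continuous : {in `]0, +oo[, continuous f}.
Proof. by have /continuous_within_itvcyP[] := f_cont. Qed.

Definition weight (tau p x : R) : R := x `^ (- tau) * r_of f (p * x).

Section weight.
Variables (tau A b : R).
Hypotheses (A0 : 0 < A) (Ab : A < b).

Let itv_gt0 x : x \in `[A, b] -> 0 < x.
Proof. by rewrite in_itv /= => /andP[/(lt_le_trans A0)]. Qed.

Lemma weight_pos (p x : R) : 0 < p -> x \in `[A, b] -> 0 < weight tau p x.
Proof.
move=> p0 /itv_gt0 x0; rewrite /weight /r_of !mulr_gt0 ?powR_gt0//.
by rewrite f_gt0// ltW// mulr_gt0.
Qed.

Lemma weight_continuous (p : R) : 0 < p ->
  {within `[A, b], continuous weight tau p}.
Proof.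
move=> p0; apply: within_continuousM.
  apply: continuous_in_subspaceT => x; rewrite inE => /itv_gt0 x0.
  apply/differentiable_continuous/derivable1_diffP/derivable_powR.
  by rewrite in_itv/= x0.
apply: (@lipschitz_within_continuous _ _ p); first exact: ltW.
move=> x y /itv_gt0 x0 /itv_gt0 y0.
apply: le_trans (r_of_lipschitz _ _) _; try by rewrite mulr_ge0// ltW.
by rewrite -mulrBr normrM gtr0_norm.
Qed.

Lemma weight_ratioE (p q x : R) : 0 < p -> 0 < q -> x \in `[A, b] ->
  weight tau p x / weight tau q x = p / q * (f (p * x) / f (q * x)).
Proof.
move=> p0 q0 /itv_gt0 x0; rewrite /weight /r_of.
have fq0 : f (q * x) != 0 by rewrite gt_eqF// f_gt0// ltW// mulr_gt0.
have xt0 : x `^ (- tau) != 0 by rewrite gt_eqF// powR_gt0.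
field; by rewrite fq0 xt0 !gt_eqF.
Qed.

Lemma profile_ratio_continuous (p q : R) : 0 < p -> 0 < q ->
  {within `[A, b], continuous (fun x => f (p * x) / f (q * x))}.
Proof.
move=> p0 q0; apply: continuous_in_subspaceT => x; rewrite inE => /itv_gt0 x0.
have cf (c : R) : 0 < c -> {for x, continuous (fun x : R => f (c * x))}.
  move=> c0; apply: continuous_comp; first exact: mulrl_continuous.
  by apply: profile_continuous; rewrite in_itv/= mulr_gt0.
apply: cvgM; first exact: cf.
by apply: cvgV; [rewrite gt_eqF// f_gt0// ltW// mulr_gt0|exact: cf].
Qed.

Lemma cab_posE (hmin a h : R) : 0 < a * h -> a * hmin = A ->
  cab_pos tau hmin f a b h = product_mean A b (r_of f) (weight tau (a * h)).
Proof.
move=> p0 eA; rewrite /cab_pos eA; congr (_ / _).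
apply: eq_Rintegral => y; rewrite inE => yin.
rewrite /inner_mean -RintegralZl//; last first.
  apply: (inner_mean_integrable A0 r_of_lipschitz) => //.
  exact: weight_continuous.
apply: eq_Rintegral => x; rewrite inE => xin.
rewrite powRM; try by apply/ltW/itv_gt0.
by rewrite /weight; ring.
Qed.

Lemma product_mean_weight_le (p q : R) : 0 < p -> 0 < q ->
  {in `[A, b] &, {homo (fun x => f (p * x) / f (q * x)) : x y / x <= y}} ->
  product_mean A b (r_of f) (weight tau q) <=
  product_mean A b (r_of f) (weight tau p).
Proof.
move=> p0 q0 mono; apply: product_mean_le => //.
- exact: r_of_lipschitz.
- exact: r_of_homo.
- exact: weight_continuous.
- exact: weight_continuous.
- by move=> x; exact: weight_pos.
- by move=> x; exact: weight_pos.
move=> x y xin yin xy; rewrite !weight_ratioE// ler_wpM2l//.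
  by rewrite divr_ge0// ltW.
exact: mono.
Qed.

Lemma product_mean_weight_lt (p q : R) : 0 < p -> 0 < q ->
  {in `[A, b] &, {homo (fun x => f (p * x) / f (q * x)) : x y / x < y}} ->
  {in `[A * A, b * b] &, {homo r_of f : s t / s < t}} ->
  product_mean A b (r_of f) (weight tau q) <
  product_mean A b (r_of f) (weight tau p).
Proof.
move=> p0 q0 mono r_smono; apply: product_mean_lt => //.
- exact: r_of_lipschitz.
- exact: r_of_homo.
- exact: weight_continuous.
- exact: weight_continuous.
- by move=> x; exact: weight_pos.
- by move=> x; exact: weight_pos.
move=> x y xin yin xy; rewrite !weight_ratioE// ltr_pM2l ?divr_gt0//.
exact: mono.
Qed.

Lemma product_mean_weight_le1 (p : R) : 0 < p ->
  product_mean A b (r_of f) (weight tau p) <= 1.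
Proof.
move=> p0; apply: product_mean_le1 => //.
- exact: r_of_lipschitz.
- exact: weight_continuous.
- by move=> x; exact: weight_pos.
- exact: r_of_le1.
Qed.

End weight.

Definition elasticity (u : R) : R := - u * derive1 f u / f u.

(** The logarithmic derivative of f(p x) is - elasticity (p x) / x. *)
Lemma profile_ratio_derive (p q x : R) : 0 < p -> 0 < q -> 0 < x ->
  derivable f (p * x) 1 -> derivable f (q * x) 1 ->
  is_derive x 1 (fun x => f (p * x) / f (q * x))
    (f (p * x) / f (q * x) / x * (elasticity (q * x) - elasticity (p * x))).
Proof.
move=> p0 q0 x0 dp dq.
have comp c : derivable f (c * x) 1 ->
    is_derive x 1 (fun x => f (c * x)) (derive1 f (c * x) * c).
  move=> dc; apply: (@is_derive1_comp _ f ( *%R c)).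
    by rewrite derive1E; exact: derivableP.
  by have := is_deriveZ c (is_derive_id x 1); rewrite [c *: 1]mulr1.
have fq0 : f (q * x) != 0 by rewrite gt_eqF// f_gt0// ltW// mulr_gt0.
have fp0 : f (p * x) != 0 by rewrite gt_eqF// f_gt0// ltW// mulr_gt0.
have x_neq0 : x != 0 by rewrite gt_eqF.
have Hp := comp _ dp; have Hq := comp _ dq.
apply: (is_derive_eq (is_deriveM Hp (is_deriveV fq0 Hq))).
rewrite /elasticity /GRing.scale /=; field.
by rewrite fq0 fp0.
Qed.

End profile.

(** * Condition F4 off the breakpoints *)

Lemma is_derive_derive1 (R : realType) (g : R -> R) (x l : R) :
  is_derive x 1 g l -> derive1 g x = l.
Proof. by move=> dg; rewrite derive1E; exact: derive_val. Qed.

Section convention.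
Variables (R : realType) (f : R -> R) (us : seq R).
Hypothesis hf : forall u : R, 0 <= u -> 0 < f u <= 1.
Hypotheses (hF1 : F1 f) (hF3 : F3 f us).

Let f_gt0 u : 0 <= u -> 0 < f u.
Proof. by move=> /hf/andP[]. Qed.

Let us_sorted : path <%R 0 us. Proof. by case: hF3. Qed.

Let f_pieces : pieces f 0 us. Proof. by case: hF3. Qed.

Let f_cont : {within `[0, +oo[, continuous f}. Proof. by case: hF3. Qed.

Definition smooth_point (u : R) : Prop := 0 < u /\ u \notin us.

Lemma smooth_point_derivable u : smooth_point u -> derivable f u 1.
Proof.
by move=> [u0 uus]; exact: (derivable_off_breakpoints us_sorted f_pieces).
Qed.

Lemma at_right_smooth_point u : 0 <= u -> \forall v \near u^'+, smooth_point v.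
Proof.
move=> u0; near=> v; split.
  by apply: le_lt_trans u0 _; near: v; exact: nbhs_right_gt.
near: v; have := dnbhs_notin u us; apply: within_subset => r /=.
by apply: contraTneq => ->; rewrite ltxx.
Unshelve. all: by end_near. Qed.

Lemma at_left_smooth_point u : 0 < u -> \forall v \near u^'-, smooth_point v.
Proof.
move=> u0; near=> v; split; first by near: v; exact: nbhs_left_gt.
near: v; have := dnbhs_notin u us; apply: within_subset => r /=.
by apply: contraTneq => ->; rewrite ltxx.
Unshelve. all: by end_near. Qed.

Lemma smooth_point_between u v : 0 <= u -> u < v ->
  exists2 t, smooth_point t & u < t < v.
Proof.
move=> u0 uv; near u^'+ => t; exists t.
  by near: t; exact: at_right_smooth_point.
by apply/andP; split; near: t; [exact: nbhs_right_gt|exact: nbhs_right_lt].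
Unshelve. all: by end_near. Qed.

Lemma fprimeE u : smooth_point u -> fprime f us u = derive1 f u.
Proof. by move=> [u0 uus]; rewrite /fprime gt_eqF// (negbTE uus). Qed.

Lemma smooth_point_derive1_le0 u : smooth_point u -> derive1 f u <= 0.
Proof.
move=> su; have [u0 _] := su; have [_ mono _] := hF1.
have uin : u \in `[0, +oo[ by rewrite in_itv/= ltW.
apply: limr_le.
  have := smooth_point_derivable su; rewrite /derivable.
  rewrite (_ : (fun h : R => _) = (fun h => h^-1 *: (f (h + u) - f u)))//.
  by apply/funext => h /=; rewrite [h%:A]mulr1.
near=> h.
have hu : h + u \in `[0, +oo[.
  rewrite in_itv/= andbT -lerBlDr sub0r ltW//; near: h.
  by apply: nbhs_dnbhs; apply: lt_nbhsr; rewrite oppr_lt0.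
have [h0|h0] := leP 0 h.
  by rewrite mulr_ge0_le0 ?invr_ge0// subr_le0 mono// lerDr.
by rewrite mulr_le0_ge0 ?invr_le0 ?subr_ge0 ?mono ?gerDr// ltW.
Unshelve. all: by end_near. Qed.

Lemma elasticity_ge0 u : smooth_point u -> 0 <= elasticity f u.
Proof.
move=> su; have [u0 _] := su; rewrite /elasticity divr_ge0//.
  by rewrite mulNr -mulrN mulr_ge0 ?oppr_ge0 ?smooth_point_derive1_le0// ltW.
exact/ltW/f_gt0/ltW.
Qed.

Lemma elasticity_cvg (u l : R) (G : set_system R) : Filter G -> 0 < u ->
  G --> nbhs u -> derive1 f v @[v --> G] --> l ->
  elasticity f v @[v --> G] --> - u * l / f u.
Proof.
move=> FG u0 Gu fl; apply: cvgM.
  by apply: cvgM => //; apply: cvgN; exact: Gu.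
apply: cvgV; first by rewrite gt_eqF// f_gt0// ltW.
have cfu : f v @[v --> u] --> f u.
  by apply: (profile_continuous f_cont); rewrite in_itv/= u0.
by apply: cvg_trans cfu; exact: cvg_app.
Qed.

Section monotone.
Hypothesis mono : forall u v, smooth_point u -> smooth_point v -> u <= v ->
  elasticity f u <= elasticity f v.

Let g u := - u * fprime f us u / f u.

Lemma breakpoint_elasticityE u : 0 < u -> u \in us ->
  g u = 2^-1 * (- u * lim (derive1 f v @[v --> u^'+]) / f u) +
        2^-1 * (- u * lim (derive1 f v @[v --> u^'-]) / f u).
Proof.
move=> u0 uus; rewrite /g /fprime gt_eqF// uus.
by rewrite mulrDr mulrDl ![- u * (2^-1 * _)]mulrCA -!mulrA.
Qed.

Let right_cvg u : 0 < u ->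
  elasticity f v @[v --> u^'+] --> - u * lim (derive1 f v @[v --> u^'+]) / f u.
Proof.
move=> u0; apply: elasticity_cvg => //; first exact: cvg_within.
by have [] := derive1_cvg_right us_sorted f_pieces (ltW u0).
Qed.

Let left_cvg u : 0 < u ->
  elasticity f v @[v --> u^'-] --> - u * lim (derive1 f v @[v --> u^'-]) / f u.
Proof.
move=> u0; apply: elasticity_cvg => //; first exact: cvg_within.
exact: (derive1_cvg_left us_sorted f_pieces u0).
Qed.

Lemma smooth_elasticity_le u v : smooth_point u -> u < v ->
  elasticity f u <= g v.
Proof.
move=> su uv; have v0 := lt_trans su.1 uv.
have [vus|vus] := boolP (v \in us); last first.
  by rewrite /g fprimeE//; apply: mono => //; exact: ltW.
have half (x : R) : x = 2^-1 * x + 2^-1 * x by field.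
rewrite breakpoint_elasticityE// [leLHS]half.
apply: lerD; rewrite ler_pM2l// ?invr_gt0//.
  have /cvg_lim <- // := right_cvg v0; apply: limr_ge.
    by apply/cvg_ex; eexists; exact: right_cvg.
  near=> t; apply: mono => //.
    by near: t; apply: at_right_smooth_point; exact: ltW.
  by apply/ltW/(lt_trans uv); near: t; exact: nbhs_right_gt.
have /cvg_lim <- // := left_cvg v0; apply: limr_ge.
  by apply/cvg_ex; eexists; exact: left_cvg.
near=> t; apply: mono => //.
  by near: t; exact: at_left_smooth_point.
by apply/ltW; near: t; exact: nbhs_left_gt.
Unshelve. all: by end_near. Qed.

Lemma smooth_elasticity_ge u v : 0 < u -> smooth_point v -> u < v ->
  g u <= elasticity f v.
Proof.
move=> u0 sv uv.
have [uus|uus] := boolP (u \in us); last first.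
  by rewrite /g fprimeE//; apply: mono => //; exact: ltW.
have half (x : R) : x = 2^-1 * x + 2^-1 * x by field.
rewrite breakpoint_elasticityE// [leRHS]half.
apply: lerD; rewrite ler_pM2l// ?invr_gt0//.
  have /cvg_lim <- // := right_cvg u0; apply: limr_le.
    by apply/cvg_ex; eexists; exact: right_cvg.
  near=> t; apply: mono => //.
    by near: t; apply: at_right_smooth_point; exact: ltW.
  by apply/ltW; near: t; exact: nbhs_right_lt.
have /cvg_lim <- // := left_cvg u0; apply: limr_le.
  by apply/cvg_ex; eexists; exact: left_cvg.
near=> t; apply: mono => //.
  by near: t; exact: at_left_smooth_point.
by apply/ltW/(lt_trans _ uv); near: t; exact: nbhs_left_lt.
Unshelve. all: by end_near. Qed.

Lemma F4_of_smooth : F4 f us.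
Proof.
move=> u v; rewrite !in_itv/= !andbT => u0 v0; rewrite le_eqVlt => /predU1P[->//|uv].
have [t st /andP[ut tv]] := smooth_point_between u0 uv.
have gv := smooth_elasticity_le st tv.
move: u0; rewrite le_eqVlt => /predU1P[u0|u0].
  by rewrite -u0 oppr0 mul0r mul0r; apply: le_trans gv; exact: elasticity_ge0.
exact: le_trans (smooth_elasticity_ge u0 st ut) gv.
Qed.

End monotone.

(** Between any two points of [0, +oo[ there is a smooth point, so monotonicity
at smooth points passes to the one-sided limits at a breakpoint and to their
average, which is the value there.  At 0 the expression of F4 vanishes, and the
elasticity is nonnegative because f is nonincreasing. *)
Lemma F4_smoothP : F4 f us <->
  forall u v, smooth_point u -> smooth_point v -> u <= v ->
    elasticity f u <= elasticity f v.
Proof.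
split; last exact: F4_of_smooth.
move=> h4 u v su sv uv; have [u0 _] := su; have [v0 _] := sv.
have := h4 u v; rewrite !in_itv/= !andbT => /(_ (ltW u0) (ltW v0) uv).
by rewrite !fprimeE.
Qed.

Lemma r_of_derive u : derivable f u 1 ->
  is_derive u 1 (r_of f) (f u + u * derive1 f u).
Proof.
move=> dfu; have df : is_derive u 1 f (derive1 f u).
  by rewrite derive1E; exact: derivableP.
apply: (is_derive_eq (is_deriveM (is_derive_id u 1) df)).
by rewrite /GRing.scale /= mulr1 addrC.
Qed.

(** Since f' has a limit at 0 from the right, r' = f + u f' tends to f(0) = 1. *)
Lemma r_of_strict_near0 : F2 f ->
  exists2 d, 0 < d & {in `[0, d] &, {homo r_of f : s t / s < t}}.
Proof.
move=> hF2; have [f0 _ _] := hF1.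
have [cf' df'] := derive1_cvg_right us_sorted f_pieces (lexx 0).
have c1 : f v + v * derive1 f v @[v --> 0^'+] --> (1 : R).
  rewrite -[X in _ --> X]addr0 -[X in _ + X](mul0r (lim (derive1 f v @[v --> 0^'+]))).
  apply: cvgD; first by have /continuous_within_itvcyP[_] := f_cont; rewrite f0.
  by apply: cvgM => //; exact: cvg_within.
have [d d0 dP] : exists2 d, 0 < d & forall v, 0 < v < d ->
    derivable f v 1 /\ 0 < f v + v * derive1 f v.
  apply: at_right_ex; near=> v; split; near: v => //.
  by apply: cvgr_gt c1 _ _.
exists d => //; apply: gtr0_derive1_lt_cc.
- move=> v; rewrite in_itv/= => /dP[dv _].
  exact: (@ex_derive _ _ _ _ _ _ _ (r_of_derive dv)).
- move=> v; rewrite in_itv/= => /dP[dv].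
  by rewrite (is_derive_derive1 (r_of_derive dv)).
- apply: (@lipschitz_within_continuous _ _ 1) => // x y.
  rewrite /= !in_itv/= => /andP[x0 _] /andP[y0 _].
  by rewrite mul1r r_of_lipschitz.
Unshelve. all: by end_near. Qed.

End convention.

(** * Both implications *)

(** Monotonicity and boundedness give the limit its existence, without which lim
would be an arbitrary value. *)
Lemma decreasing_lim_at_right0 (R : realType) (c : R -> R) (h : R) :
  (forall s t, 0 < s -> s <= t -> c t <= c s) -> (forall s, 0 < s -> c s <= 1) ->
  0 < h -> c h <= lim (c t @[t --> 0^'+]).
Proof.
move=> mono c1 h0; apply: limr_ge.
  apply: nonincreasing_at_right_is_cvgr; near=> x.
    move=> s t; rewrite !in_itv/= => /andP[s0 _] _ st; exact: mono.
  exists 1 => _ [s /= + <-]; rewrite in_itv/= => /andP[s0 _]; exact: c1.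
near=> t; apply: mono; near: t; [exact: nbhs_right_gt|exact: nbhs_right_le].
Unshelve. all: by end_near. Qed.

Section main.
Variables (R : realType) (tau hmin : R) (f : R -> R) (us : seq R).
Hypothesis hhmin : 0 < hmin.
Hypothesis hf : forall u : R, 0 <= u -> 0 < f u <= 1.
Hypotheses (hF1 : F1 f) (hF2 : F2 f) (hF3 : F3 f us).

Let f_cont : {within `[0, +oo[, continuous f}. Proof. by case: hF3. Qed.

Lemma profile_ratio_homo (A b p q : R) : F4 f us -> 0 < A -> 0 < p -> p <= q ->
  {in `[A, b] &, {homo (fun x => f (p * x) / f (q * x)) : x y / x <= y}}.
Proof.
move=> /(F4_smoothP hf hF1 hF3) h4 A0 p0 pq x y xin yin xy.
have q0 := lt_le_trans p0 pq.
have x0 : 0 < x by move: xin; rewrite in_itv/= => /andP[/(lt_le_trans A0)].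
(* The points x for which p x or q x is a breakpoint. *)
pose bad := [seq u / p | u <- us] ++ [seq u / q | u <- us].
have badP z : z \notin bad -> p * z \notin us /\ q * z \notin us.
  rewrite mem_cat negb_or => /andP[np nq]; split.
    by apply: contraNN np => pz;
      apply/mapP; exists (p * z) => //; field; rewrite gt_eqF.
  by apply: contraNN nq => pz;
    apply/mapP; exists (q * z) => //; field; rewrite gt_eqF.
move: xy; rewrite le_eqVlt => /predU1P[->//|xy].
apply: (@ge0_derive1_le_off_seq _ bad (fun x => f (p * x) / f (q * x))).
- exact: ltW.
- exact: (profile_ratio_continuous hf f_cont).
move=> z; rewrite in_itv/= => /andP[xz zy] /badP[pz qz].
have z0 := lt_trans x0 xz.
have sp : smooth_point us (p * z) by split => //; rewrite mulr_gt0.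
have sq : smooth_point us (q * z) by split => //; rewrite mulr_gt0.
have dQ := profile_ratio_derive hf p0 q0 z0
  (smooth_point_derivable hF3 sp) (smooth_point_derivable hF3 sq).
split; first exact: (@ex_derive _ _ _ _ _ _ _ dQ).
rewrite derive1E; have [_ ->] := dQ.
have fgt0 c : 0 < c -> 0 < f (c * z).
  by move=> c0; have /andP[] := hf (ltW (mulr_gt0 c0 z0)).
apply: mulr_ge0; first by apply/ltW; rewrite !divr_gt0 ?fgt0.
rewrite subr_ge0.
by apply: h4 => //; rewrite ler_wpM2r// ltW.
Qed.

Lemma cab_decreasing (a b : R) : F4 f us -> 0 < a -> a * hmin < b ->
  {in `[0, +oo[ &, nonincreasing_fun (cab tau hmin f a b)}.
Proof.
move=> h4 a0 Ab.
have A0 : 0 < a * hmin by rewrite mulr_gt0.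
have posE h : 0 < h -> cab_pos tau hmin f a b h =
    product_mean (a * hmin) b (r_of f) (weight f tau (a * h)).
  by move=> h0; apply: cab_posE => //; rewrite mulr_gt0.
have pos_le s t : 0 < s -> s <= t ->
    cab_pos tau hmin f a b t <= cab_pos tau hmin f a b s.
  move=> s0 st; have t0 := lt_le_trans s0 st; rewrite !posE//.
  apply: product_mean_weight_le => //; try by rewrite mulr_gt0.
  by apply: profile_ratio_homo => //; rewrite ?mulr_gt0// ler_wpM2l// ltW.
have pos_le1 s : 0 < s -> cab_pos tau hmin f a b s <= 1.
  by move=> s0; rewrite posE//; apply: product_mean_weight_le1 => //; rewrite mulr_gt0.
move=> s t; rewrite !in_itv/= !andbT => s0 t0 st; rewrite /cab.
move: s0; rewrite le_eqVlt => /predU1P[s0|s0].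
  rewrite -s0 eqxx; case: eqVneq => // t_neq0.
  by apply: decreasing_lim_at_right0 => //; rewrite lt_neqAle eq_sym t_neq0.
by rewrite !gt_eqF ?pos_le// (lt_le_trans s0).
Qed.

(** The interval [A, b] is so short that p x and q x stay close to u and v, where
the elasticities keep the order they have at u and v, and so close to 0 that r
is strictly increasing at the products x y. *)
Lemma cab_increase (u v : R) : smooth_point us u -> smooth_point us v -> u < v ->
  elasticity f v < elasticity f u ->
  exists a b h1 h2, [/\ 0 < a, 0 < b, a * hmin < b, 0 < h1 < h2 &
    cab tau hmin f a b h1 < cab tau hmin f a b h2].
Proof.
move=> su sv uv evu; have [u0 _] := su; have [v0 _] := sv.
pose m := (elasticity f v + elasticity f u) / 2.
have near_right w : smooth_point us w ->
    elasticity f t @[t --> w^'+] --> elasticity f w /\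
    \forall t \near w^'+, derivable f t 1.
  move=> [w0 wus]; have [_ us_sorted fk fl] := hF3.
  have f_pieces : pieces f 0 us by [].
  split; last by have [] := derive1_cvg_right us_sorted f_pieces (ltW w0).
  apply: (elasticity_cvg hf hF3 _ w0); first exact: cvg_within.
  exact: (derive1_right_continuous us_sorted f_pieces).
have [d1 ud1 d1P] : exists2 d, u < d & forall t, u < t < d ->
    derivable f t 1 /\ m < elasticity f t.
  have [cu du] := near_right _ su.
  apply: at_right_ex; near=> t; split; near: t => //.
  by apply: (cvgr_gt _ cu); rewrite midf_lt.
have [d2 vd2 d2P] : exists2 d, v < d & forall t, v < t < d ->
    derivable f t 1 /\ elasticity f t < m.
  have [cv dv] := near_right _ sv.
  apply: at_right_ex; near=> t; split; near: t => //.
  by apply: (cvgr_lt _ cv); rewrite midf_lt.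
have [d d0 r_smono] := r_of_strict_near0 hf hF1 hF3 hF2.
(* With b <= e <= 1 and e <= d one has b^2 <= d, so r is strictly increasing
   on [A^2, b^2]; the two other bounds on b keep p x below d1 and q x below
   d2. *)
have [e [e0 ed e1]] : exists e : R, [/\ 0 < e, e <= d & e <= 1].
  by exists (Num.min 1 d); rewrite lt_min ltr01 d0 !ge_min !lexx orbT.
pose A := e / 2.
have A0 : 0 < A by rewrite divr_gt0.
pose b := Num.min e (Num.min (d1 * (A / u)) (d2 * (A / v))).
have Ab : A < b.
  rewrite !lt_min ![_ * (A / _)]mulrA; apply/and3P; split.
  - by rewrite ltr_pdivrMr// ltr_pMr// ltr1n.
  - by rewrite ltr_pdivlMr// mulrC ltr_pM2r.
  - by rewrite ltr_pdivlMr// mulrC ltr_pM2r.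
have b0 := lt_trans A0 Ab.
(* The left end A of the interval is sent to u by p and to v by q. *)
pose p := u / A; pose q := v / A.
have p0 : 0 < p by rewrite divr_gt0.
have q0 : 0 < q by rewrite divr_gt0.
(* The values of h are h1 = p / a and h2 = q / a, so that a h1 = p and a h2 = q. *)
pose a := A / hmin.
have a0 : 0 < a by rewrite divr_gt0.
have eA : a * hmin = A by rewrite divfK// gt_eqF.
have ap : a * (p / a) = p by rewrite mulrC divfK// gt_eqF.
have aq : a * (q / a) = q by rewrite mulrC divfK// gt_eqF.
exists a, b, (p / a), (q / a); split => //; first by rewrite eA.
  by rewrite divr_gt0// ltr_pM2r ?invr_gt0// ltr_pM2r ?invr_gt0.
rewrite /cab !gt_eqF ?divr_gt0//.
rewrite (cab_posE hf hF1 hF2 tau b A0) ?ap//.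
rewrite (cab_posE hf hF1 hF2 tau b A0) ?aq//.
have be : b <= e by rewrite ge_min lexx.
apply: product_mean_weight_lt => //; last first.
  have sub s : s \in `[A * A, b * b] -> s \in `[0, d].
    rewrite !in_itv/= => /andP[As sb]; apply/andP; split.
      by apply: le_trans As; rewrite mulr_ge0// ltW.
    apply: (le_trans sb); apply: le_trans ed; rewrite -[leRHS]mulr1.
    by apply: ler_pM => //; [exact: ltW|exact: ltW|exact: le_trans be e1].
  by move=> s t sin tin; apply: r_smono; exact: sub.
have dT x : x \in `]A, b[ ->
    is_derive x 1 (fun x => f (q * x) / f (p * x))
      (f (q * x) / f (p * x) / x * (elasticity f (p * x) - elasticity f (q * x))) /\
    0 < f (q * x) / f (p * x) / x * (elasticity f (p * x) - elasticity f (q * x)).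
  rewrite in_itv/= => /andP[Ax xb]; have x0 := lt_trans A0 Ax.
  have /andP[x1 x2] : (x < d1 * (A / u)) && (x < d2 * (A / v)).
    by move: xb; rewrite !lt_min => /and3P[_ -> ->].
  have [dp ep] : derivable f (p * x) 1 /\ m < elasticity f (p * x).
    apply: d1P; apply/andP; split.
      by rewrite /p mulrAC ltr_pdivlMr// ltr_pM2l.
    by rewrite -ltr_pdivlMl// invf_div mulrC.
  have [dq eq] : derivable f (q * x) 1 /\ elasticity f (q * x) < m.
    apply: d2P; apply/andP; split.
      by rewrite /q mulrAC ltr_pdivlMr// ltr_pM2l.
    by rewrite -ltr_pdivlMl// invf_div mulrC.
  split; first exact: (profile_ratio_derive hf).
  have fgt0 c : 0 < c -> 0 < f (c * x).
    by move=> c0; have /andP[] := hf (ltW (mulr_gt0 c0 x0)).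
  by rewrite mulr_gt0 ?divr_gt0 ?fgt0// subr_gt0 (lt_trans eq).
apply: gtr0_derive1_lt_cc.
- by move=> x /dT[dx _]; exact: (@ex_derive _ _ _ _ _ _ _ dx).
- by move=> x /dT[dx pos]; rewrite (is_derive_derive1 dx).
- exact: (profile_ratio_continuous hf f_cont).
Unshelve. all: by end_near. Qed.

Lemma F4_of_cab_decreasing :
  (forall a b : R, 0 < a -> 0 < b -> a * hmin < b ->
     {in `[0, +oo[ &, nonincreasing_fun (cab tau hmin f a b)}) -> F4 f us.
Proof.
move=> dec; apply/(F4_smoothP hf hF1 hF3) => u v su sv.
rewrite le_eqVlt => /predU1P[->//|uv].
rewrite leNgt; apply/negP => evu.
have [a [b [h1 [h2 [a0 b0 Ab /andP[h10 h12]]]]]] := cab_increase su sv uv evu.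
apply/negP; rewrite -leNgt; apply: dec => //; last exact: ltW.
- by rewrite in_itv/= ltW.
- by rewrite in_itv/= ltW// (lt_trans h10).
Qed.

End main.

Theorem proposition1 (R : realType) (tau hmin : R) (f : R -> R) (us : seq R)
  (htau : 2 < tau < 3) (hhmin : 0 < hmin)
  (hf : forall u : R, 0 <= u -> 0 < f u <= 1)
  (hF1 : F1 f) (hF2 : F2 f) (hF3 : F3 f us) :
  (forall a b : R, 0 < a -> 0 < b -> a * hmin < b ->
     {in `[0, +oo[ &, nonincreasing_fun (cab tau hmin f a b)})
  <-> F4 f us.
Proof.
split; first exact: (F4_of_cab_decreasing hhmin hf hF1 hF2 hF3).
by move=> h4 a b a0 _; exact: (cab_decreasing tau hhmin hf hF1 hF2 hF3 h4 a0).
Qed.
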